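(* A valid exchange of two colours preserves the product of their permutation signs: if $P,Q$ are permutations of a finite set $X$, $U\subseteq X$, and the maps $P',Q':X\to X$ defined by $P'=Q$, $Q'=P$ on $U$ and $P'=P$, $Q'=Q$ on $X\setminus U$ are both permutations, then $\mathrm{sgn}(P')\,\mathrm{sgn}(Q')=\mathrm{sgn}(P)\,\mathrm{sgn}(Q)$. Consequently, for even $m\ge 2$ and odd $d\ge3$, no finite sequence of valid exchanges of two colours transforms the canonical coordinate factorization of $D_d(m)$ into a Hamilton decomposition.
   Context: $D_d(m)$ is the digraph on $\mathbb Z_m^d$ with arcs $x\to x+e_i$ ($1\le i\le d$). A factorization of $D_d(m)$ is a list of permutations $S_1,\dots,S_d$ of $\mathbb Z_m^d$ (one per colour) such that at each vertex $x$ the values $S_1(x),\dots,S_d(x)$ are $x+e_1,\dots,x+e_d$ in some order. The canonical coordinate factorization is $S_c(x)=x+e_c$. A factorization is a Hamilton decomposition if every $S_c$ is a single cycle on $\mathbb Z_m^d$. A valid exchange of two colours $c\neq c'$ on a set $U$ of vertices swaps the values of $S_c$ and $S_{c'}$ at every vertex of $U$, leaving everything else fixed, under the condition that the two new maps are again permutations; successive exchanges may use different pairs of colours and different sets. *)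

(* Defs.v *)
From HB Require Import structures.
From mathcomp Require Import all_boot all_order all_algebra all_fingroup.

Set Implicit Arguments.
Unset Strict Implicit.
Unset Printing Implicit Defensive.

Import GRing.Theory.
Local Open Scope ring_scope.

Definition sgn (X : finType) (P : {perm X}) : int := (-1) ^+ (odd_perm P).

Definition swap_on (X : finType) (U : {set X}) (f g : X -> X) : X -> X :=
  fun x => if x \in U then g x else f x.

(* The vertex set of D_d(m); 'Z_m is the ring of integers mod m only when
   1 < m. *)
Definition vertex (d m : nat) : finType := 'rV['Z_m]_d.

Definition dir (d m : nat) (i : 'I_d) : 'rV['Z_m]_d := delta_mx 0 i.

Definition colouring (d m : nat) : finType :=
  {ffun 'I_d -> {perm (vertex d m)}}.

Definition is_factorization (d m : nat) (S : colouring d m) : bool :=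
  [forall x : 'rV['Z_m]_d, exists s : {perm 'I_d},
     forall c : 'I_d, S c x == x + dir m (s c)].

Definition canonical (d m : nat) : colouring d m :=
  [ffun c => perm (@addIr 'rV['Z_m]_d (dir m c))].

Definition is_hamilton_decomposition (d m : nat) (S : colouring d m) : bool :=
  is_factorization S && [forall c, #|porbits (S c)| == 1%N].

(* Validity of the exchange, i.e. bijectivity of the two new maps, is enforced
   by S' being a family of permutations. *)
Definition valid_exchange (d m : nat) : rel (colouring d m) := fun S S' =>
  [exists c : 'I_d, exists c' : 'I_d, exists U : {set vertex d m},
    [&& c != c',
        [forall x, S' c x == swap_on U (S c) (S c') x],
        [forall x, S' c' x == swap_on U (S c') (S c) x]
      & [forall k, (k != c) && (k != c') ==> (S' k == S k)]]].

(* Main.v *)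
Require Import Defs.
From mathcomp Require Import all_boot all_order all_algebra all_fingroup.

(** An exchange of two colours multiplies one of the maps by a permutation [A]
    and the other by [A^-1], so it changes both signs by the same factor
    ([swap_sgn]).  Hence the product of the signs of all [d] colours is
    invariant under valid exchanges ([sgn_prod_exchange]).

    For even [m] and odd [d >= 3] this product separates the canonical
    factorization from every Hamilton decomposition.  A coordinate translation
    has [m ^ d.-1] cycles on the [m ^ d] vertices ([card_porbits_canonical]);
    both numbers are even, so it is an even permutation and the canonical
    product is [1].  A single cycle on an even number of vertices is odd, so for
    a Hamilton decomposition the product is [(-1) ^+ d = -1]. *)

Import GRing.Theory.
Local Open Scope ring_scope.

Lemma sgnM (X : finType) (P Q : {perm X}) : sgn (P * Q)%g = sgn P * sgn Q.
Proof. by rewrite /sgn odd_permM signr_addb. Qed.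

(** Let [A x] be [P^-1 (P' x)]: it is [P^-1 (Q x)] on [U] and [x] elsewhere.
    Since [P'] is injective, [A] maps [U] into itself, and therefore [Q'] takes
    [A x] back to [Q x] for every [x].  So [P' = P o A] and [Q' = Q o A^-1]. *)
Lemma swap_sgn (X : finType) (U : {set X}) (P Q P' Q' : {perm X}) :
    P' =1 swap_on U P Q -> Q' =1 swap_on U Q P ->
  sgn P' * sgn Q' = sgn P * sgn Q.
Proof.
move=> defP' defQ'; pose A := (P' * P^-1)%g.
have defQ : (A * Q')%g = Q.
  apply/permP=> x; rewrite !permM defP' {1}/swap_on.
  case: ifPn => [Ux | U'x]; last by rewrite permK defQ' /swap_on (negPf U'x).
  set y := (P^-1)%g _; have Py : P y = Q x by rewrite /y permKV.
  rewrite defQ' /swap_on; case: ifPn => // U'y.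
  have eq_yx : y = x.
    by apply: (@perm_inj _ P'); rewrite !defP' /swap_on Ux (negPf U'y).
  by rewrite eq_yx Ux in U'y.
have -> : sgn P' = sgn A * sgn P by rewrite -sgnM /A mulgKV.
by rewrite -defQ sgnM -mulrA mulrCA.
Qed.

Definition sgn_prod (d m : nat) (S : colouring d m) : int :=
  \prod_(c < d) sgn (S c).

Lemma sgn_prod_exchange (d m : nat) (S S' : colouring d m) :
  valid_exchange S S' -> sgn_prod d m S' = sgn_prod d m S.
Proof.
case/existsP=> c /existsP[c' /existsP[U]].
case/and4P=> neq_cc' /forallP Sc /forallP Sc' /forallP Sk.
have c'P : c' != c by rewrite eq_sym.
rewrite /sgn_prod !(bigD1 (P := xpredT) c) //=.
rewrite !(bigD1 (P := [pred i | i != c]) c') //= !mulrA.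
congr (_ * _); first by apply: (@swap_sgn _ U) => x; apply/eqP.
by apply: eq_bigr => k kP; rewrite (eqP (implyP (Sk k) kP)).
Qed.

Lemma sgn_prod_path (d m : nat) (S : colouring d m) (s : seq (colouring d m)) :
  path (@valid_exchange d m) S s -> sgn_prod d m (last S s) = sgn_prod d m S.
Proof. by elim: s S => //= S' s IHs S /andP[/sgn_prod_exchange <- /IHs]. Qed.

Lemma card_vertex (d m : nat) : (1 < m)%N -> #|vertex d m| = (m ^ d)%N.
Proof. by move=> m_gt1; rewrite card_mx card_ord Zp_cast // mul1n. Qed.

Lemma porbits_partition (X : finType) (s : {perm X}) :
  partition (porbits s) [set: X].
Proof.
have -> : porbits s = orbit 'P <[s]> @: [set: X].
  by apply/setP=> B; apply/imsetP/imsetP=> -[x _ ->]; exists x; rewrite ?porbitE.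
by apply/orbit_partition/actsP=> a _ x; rewrite !inE.
Qed.

Lemma canonical_iter (d m : nat) (c : 'I_d) (n : nat) (x : 'rV['Z_m]_d) :
  (canonical d m c ^+ n)%g x = x + n%:R *: dir m c.
Proof.
elim: n => [|n IHn]; first by rewrite expg0 perm1 scale0r addr0.
by rewrite expgSr permM IHn ffunE permE mulrSr scalerDl scale1r addrA.
Qed.

(** The cycles of a coordinate translation are the lines in its direction,
    each parametrized injectively by the integers mod [m]. *)
Lemma card_porbit_canonical (d m : nat) (c : 'I_d) (x : vertex d m) :
  (1 < m)%N -> #|porbit (canonical d m c) x| = m.
Proof.
move=> m_gt1.
pose line (a : 'Z_m) : vertex d m := (x : 'rV['Z_m]_d) + a *: dir m c.
have -> : porbit (canonical d m c) x = [set line a | a in 'Z_m].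
  apply/setP=> y; apply/porbitP/imsetP=> [[n ->] | [a _ ->]].
    by exists n%:R; rewrite ?canonical_iter.
  by exists a; rewrite canonical_iter natr_Zp.
rewrite card_imset ?card_ord ?Zp_cast // => a b /addrI/matrixP/(_ 0 c).
by rewrite !mxE !eqxx !mulr1.
Qed.

Lemma card_porbits_canonical (d m : nat) (c : 'I_d) :
  (1 < m)%N -> #|porbits (canonical d m c)| = (m ^ d.-1)%N.
Proof.
move=> m_gt1; have m_gt0 := ltnW m_gt1.
have d_gt0 : (0 < d)%N := leq_ltn_trans (leq0n c) (ltn_ord c).
apply/eqP; rewrite -(eqn_pmul2r m_gt0) -expnSr prednK //.
rewrite -card_vertex // -cardsT; apply/eqP/esym.
apply: card_uniform_partition (porbits_partition _ _) => _ /imsetP[x _ ->].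
exact: card_porbit_canonical.
Qed.

Lemma sgn_canonical (d m : nat) (c : 'I_d) :
  (1 < m)%N -> ~~ odd m -> (1 < d)%N -> sgn (canonical d m c) = 1.
Proof.
move=> m_gt1 m_even d_gt1; rewrite /sgn /odd_perm card_vertex //.
rewrite card_porbits_canonical // !oddX (negPf m_even) !orbF.
by case: d d_gt1 {c} => [|[]].
Qed.

Lemma sgn_single_cycle (X : finType) (P : {perm X}) :
  ~~ odd #|X| -> #|porbits P| = 1%N -> sgn P = -1.
Proof. by rewrite /sgn /odd_perm => /negPf-> ->. Qed.

Theorem proposition5p3 :
  (forall (X : finType) (P Q : {perm X}) (U : {set X})
          (injP' : injective (swap_on U P Q))
          (injQ' : injective (swap_on U Q P)),
     sgn (perm injP') * sgn (perm injQ') = sgn P * sgn Q)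
  /\
  (forall m d : nat, (2 <= m)%N -> ~~ odd m -> (3 <= d)%N -> odd d ->
     ~ exists2 s : seq (colouring d m),
         path (@valid_exchange d m) (canonical d m) s
         & is_hamilton_decomposition (last (canonical d m) s)).
Proof.
split=> [X P Q U injP' injQ' | m d m_gt1 m_even d_gt2 d_odd].
  by apply: (@swap_sgn X U) => x; rewrite permE.
have d_gt1 := ltnW d_gt2; have d_gt0 := ltnW d_gt1.
case=> s /sgn_prod_path eq_prod /andP[_ /forallP ham].
have vertex_even : ~~ odd #|vertex d m|.
  by rewrite card_vertex // oddX (negPf m_even) orbF -lt0n.
move: eq_prod; rewrite /sgn_prod.
under eq_bigr => c _ do rewrite (sgn_single_cycle _ _ vertex_even (eqP (ham c))).
under [in RHS]eq_bigr => c _ do rewrite sgn_canonical //.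
by rewrite !prodr_const card_ord expr1n -signr_odd d_odd.
Qed.
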